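(* Let $p$ be a prime and let $\Gamma=H_1*_K H_2$ be an amalgamated free product of abstract groups with common subgroup $K$, where $K\trianglelefteq H_i$ and $H_i/K$ is a finite $p$-group for $i=1,2$. Assume that $K$ has a family $\mathcal L$ of characteristic subgroups of finite $p$-power index which is cofinal, in the sense that for every normal subgroup $U\triangleleft K$ of finite $p$-power index there is $L\in\mathcal L$ with $L\leq U$, and assume that, for every $L\in\mathcal L$, the subgroup of $\operatorname{Aut}(K/L)$ generated by the conjugation actions of $H_1$ and $H_2$ on $K/L$ is a $p$-group. Then the natural maps give $\widehat\Gamma_p\cong\widehat{(H_1)}_p\amalg_{\widehat K_p}\widehat{(H_2)}_p$ as a proper pro-$p$ amalgam.
   Context: $\widehat G_p$ denotes the pro-$p$ completion of an abstract group $G$. For pro-$p$ groups $G_1,G_2$ with a common closed subgroup $A$, $G_1\amalg_A G_2$ is the pushout of $G_1\leftarrow A\rightarrow G_2$ in the category of pro-$p$ groups; it is proper if the canonical maps $G_i\to G_1\amalg_A G_2$ are injective. The conclusion means: the natural maps $\widehat K_p\to\widehat{(H_i)}_p$ are injective (so that $\widehat K_p$ is a common closed subgroup), the resulting pro-$p$ amalgam is proper, and the natural map $\widehat{(H_1)}_p\amalg_{\widehat K_p}\widehat{(H_2)}_p\to\widehat\Gamma_p$ induced by the inclusions $H_i\hookrightarrow\Gamma$ is an isomorphism. *)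

(* Defs.v *)
From HB Require Import structures.
From mathcomp Require Import fingroup morphism pgroup.
From mathcomp Require Import all_boot all_order.
From mathcomp Require Import all_classical topology.

Set Implicit Arguments.
Unset Strict Implicit.
Unset Printing Implicit Defensive.

Local Open Scope classical_set_scope.
Local Open Scope quotient_scope.
Local Open Scope group_scope.

Definition is_subgroup (G : groupType) (S : set G) : Prop :=
  S 1 /\ forall x y, S x -> S y -> S (x^-1 * y).

Definition is_normal (G : groupType) (N : set G) : Prop :=
  is_subgroup N /\ forall x g, N x -> N (x ^ g).

Definition generated_subgroup (G : groupType) (A : set G) : set G :=
  \bigcap_(S in [set S : set G | is_subgroup S /\ A `<=` S]) S.

Record normalSubgroup (G : groupType) := NormalSubgroup {
  normal_set :> set G;
  normal_setP : is_normal normal_set }.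

Section SubgroupTheory.
Variables (G : groupType) (S : set G).
Hypothesis SP : is_subgroup S.

Lemma is_subgroupV x : S x -> S x^-1.
Proof. by move=> Sx; rewrite -[x^-1]mulg1; apply: SP.2 => //; apply: SP.1. Qed.

Lemma is_subgroupM x y : S x -> S y -> S (x * y).
Proof. by move=> /is_subgroupV Sx Sy; rewrite -[x]invgK; apply: SP.2. Qed.

End SubgroupTheory.

Section Quotient.
Variables (G : groupType) (N : normalSubgroup G).

Let Nsub : is_subgroup N := (normal_setP N).1.

Definition same_coset (x y : G) : bool := `[< normal_set N (x^-1 * y) >].

Fact same_coset_refl : reflexive same_coset.
Proof. by move=> x; apply/asboolP; rewrite mulVg; exact: Nsub.1. Qed.

Fact same_coset_sym : symmetric same_coset.
Proof.
by move=> x y; apply/asboolP/asboolP => /(is_subgroupV Nsub);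
  rewrite invgM invgK.
Qed.

Fact same_coset_trans : transitive same_coset.
Proof.
move=> y x z /asboolP xy /asboolP yz; apply/asboolP.
by have := is_subgroupM Nsub xy yz; rewrite -!mulgA mulVKg.
Qed.

Canonical same_coset_equiv :=
  EquivRel same_coset same_coset_refl same_coset_sym same_coset_trans.

Definition quot := {eq_quot same_coset}.
HB.instance Definition _ := Choice.on quot.

Definition quot_proj (x : G) : quot := \pi_{eq_quot same_coset} x.

Lemma quot_projP x y :
  quot_proj x = quot_proj y <-> normal_set N (x^-1 * y).
Proof.
split=> [/eqmodP/asboolP //|Nxy].
by apply/eqmodP/asboolP.
Qed.

Lemma quot_proj_surj (a : quot) : exists x, a = quot_proj x.
Proof. by exists (repr a); rewrite /quot_proj reprK. Qed.

Definition quot_one : quot := quot_proj 1.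
Definition quot_inv (a : quot) : quot := quot_proj (repr a)^-1.
Definition quot_mul (a b : quot) : quot := quot_proj (repr a * repr b).

Let repr_proj x : normal_set N ((repr (quot_proj x))^-1 * x).
Proof. by apply/quot_projP; rewrite /quot_proj reprK. Qed.

Fact quot_mulE x y : quot_mul (quot_proj x) (quot_proj y) = quot_proj (x * y).
Proof.
apply/quot_projP; rewrite invgM.
have /(_ y) := (normal_setP N).2 _ _ (repr_proj x).
move=> /(is_subgroupM Nsub (repr_proj y)).
by rewrite conjgE -!mulgA mulVKg.
Qed.

Fact quot_invE x : quot_inv (quot_proj x) = quot_proj x^-1.
Proof.
apply/quot_projP; rewrite invgK.
have /(is_subgroupV Nsub) := repr_proj x.
rewrite invgM invgK => /((normal_setP N).2 _ (x^-1)).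
by rewrite conjgE invgK !mulgA mulgV mul1g.
Qed.

Fact quot_mulA : associative quot_mul.
Proof.
move=> a b c; have [x ->] := quot_proj_surj a.
have [y ->] := quot_proj_surj b; have [z ->] := quot_proj_surj c.
by rewrite !quot_mulE mulgA.
Qed.

Fact quot_mul1 : left_id quot_one quot_mul.
Proof. by move=> a; have [x ->] := quot_proj_surj a; rewrite quot_mulE mul1g. Qed.

Fact quot_1mul : right_id quot_one quot_mul.
Proof. by move=> a; have [x ->] := quot_proj_surj a; rewrite quot_mulE mulg1. Qed.

Fact quot_mulV : left_inverse quot_one quot_inv quot_mul.
Proof.
by move=> a; have [x ->] := quot_proj_surj a; rewrite quot_invE quot_mulE mulVg.
Qed.

Fact quot_Vmul : right_inverse quot_one quot_inv quot_mul.
Proof.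
by move=> a; have [x ->] := quot_proj_surj a; rewrite quot_invE quot_mulE mulgV.
Qed.

HB.instance Definition _ :=
  isGroup.Build quot quot_mulA quot_mul1 quot_1mul quot_mulV quot_Vmul.

Fact quot_proj_is_multiplicative : {morph quot_proj : x y / x * y}.
Proof. by move=> x y; rewrite -quot_mulE. Qed.
HB.instance Definition _ :=
  isMultiplicative.Build G quot quot_proj quot_proj_is_multiplicative.

End Quotient.

Section Automorphisms.
Variable G : groupType.

Record aut := Aut {
  aut_fun :> G -> G;
  aut_inv : G -> G;
  aut_morph : {morph aut_fun : x y / x * y};
  aut_funK : cancel aut_fun aut_inv;
  aut_invK : cancel aut_inv aut_fun }.

HB.instance Definition _ := gen_eqMixin aut.
HB.instance Definition _ := gen_choiceMixin aut.

Lemma autP (a b : aut) : a =1 b -> a = b.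
Proof.
case: a b => [f f' fM fK f'K] [g g' gM gK g'K] /= /funext fg.
case: _ / fg in gM gK g'K *.
have e : f' = g' by apply/funext => x; rewrite -{1}[x]g'K fK.
case: _ / e in gK g'K *.
by congr Aut; exact: Prop_irrelevance.
Qed.

Definition aut_one : aut :=
  @Aut id id (fun _ _ => erefl) (fun _ => erefl) (fun _ => erefl).

Definition aut_mul (a b : aut) : aut.
Proof.
refine (@Aut (a \o b) (aut_inv b \o aut_inv a) _ _ _).
- by move=> x y /=; rewrite !aut_morph.
- by move=> x /=; rewrite !aut_funK.
- by move=> x /=; rewrite !aut_invK.
Defined.

Definition aut_opp (a : aut) : aut.
Proof.
refine (@Aut (aut_inv a) a _ (@aut_invK a) (@aut_funK a)).
by move=> x y; apply: (can_inj (@aut_funK a)); rewrite aut_morph !aut_invK.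
Defined.

Fact aut_mulA : associative aut_mul. Proof. by move=> a b c; exact: autP. Qed.
Fact aut_mul1 : left_id aut_one aut_mul. Proof. by move=> a; exact: autP. Qed.
Fact aut_1mul : right_id aut_one aut_mul. Proof. by move=> a; exact: autP. Qed.
Fact aut_mulV : left_inverse aut_one aut_opp aut_mul.
Proof. by move=> a; apply: autP => x /=; rewrite aut_funK. Qed.
Fact aut_Vmul : right_inverse aut_one aut_opp aut_mul.
Proof. by move=> a; apply: autP => x /=; rewrite aut_invK. Qed.

HB.instance Definition _ :=
  isGroup.Build aut aut_mulA aut_mul1 aut_1mul aut_mulV aut_Vmul.

End Automorphisms.

Definition is_characteristic (G : groupType) (L : set G) : Prop :=
  is_subgroup L /\ forall (a : aut G) x, L x -> L (a x).

Definition is_finite_pgroup (p : nat) (G : groupType) (S : set G) : Prop :=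
  exists (P : finGroupType) (f : {multiplicative P -> G}),
    [/\ p.-group [set: P]%SET, injective f & range f = S].

Definition p_index (p : nat) (G : groupType) (N : normalSubgroup G) : Prop :=
  is_finite_pgroup p [set: quot N].

(* K is identified with its image under [k] in H. When [k] is injective, k(K) is
   normal and L is characteristic in K, exactly one [a] satisfies this: the
   automorphism of K / L induced by conjugation by [h]. *)
Definition induced_by_conj (K H : groupType) (k : K -> H)
    (L : normalSubgroup K) (h : H) (a : aut (quot L)) : Prop :=
  forall x y : K, k y = k x ^ h -> a (quot_proj L x) = quot_proj L y.

Definition conj_action (K H : groupType) (k : K -> H)
    (L : normalSubgroup K) : set (aut (quot L)) :=
  [set a | exists h, induced_by_conj k h a].
Arguments conj_action {K H} k L.

(* When [k1] and [k2] are injective, this says that [G] is the amalgamated free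
   product of [H1] and [H2] over the common subgroup [K]. *)
Definition is_group_pushout (K H1 H2 G : groupType)
    (k1 : {multiplicative K -> H1}) (k2 : {multiplicative K -> H2})
    (i1 : {multiplicative H1 -> G}) (i2 : {multiplicative H2 -> G}) : Prop :=
  i1 \o k1 =1 i2 \o k2 /\
  forall (T : groupType)
      (g1 : {multiplicative H1 -> T}) (g2 : {multiplicative H2 -> T}),
    g1 \o k1 =1 g2 \o k2 ->
    (exists u : {multiplicative G -> T}, u \o i1 =1 g1 /\ u \o i2 =1 g2) /\
    (forall u v : {multiplicative G -> T},
      u \o i1 =1 v \o i1 -> u \o i2 =1 v \o i2 -> u =1 v).

HB.mixin Record isTopGroup G & Group G & Topological G := {
  mulg_continuous : continuous (fun xy : G * G => xy.1 * xy.2);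
  invg_continuous : continuous (fun x : G => x^-1) }.

#[short(type="topGroupType")]
HB.structure Definition TopGroup :=
  { G of Group G & Topological G & isTopGroup G }.

Definition is_pro_p (p : nat) (G : topGroupType) : Prop :=
  [/\ compact [set: G], hausdorff_space G, totally_disconnected [set: G] &
      forall N : normalSubgroup G, open (normal_set N) -> p_index p N].

Definition is_top_iso (G H : topGroupType) (u : {multiplicative G -> H}) :
    Prop :=
  continuous u /\ exists2 v : H -> G, continuous v & cancel u v /\ cancel v u.

Definition is_pro_p_pushout (p : nat) (A G1 G2 P : topGroupType)
    (f1 : {multiplicative A -> G1}) (f2 : {multiplicative A -> G2})
    (j1 : {multiplicative G1 -> P}) (j2 : {multiplicative G2 -> P}) : Prop :=
  [/\ is_pro_p p P, continuous j1, continuous j2, j1 \o f1 =1 j2 \o f2 &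
   forall (T : topGroupType)
      (g1 : {multiplicative G1 -> T}) (g2 : {multiplicative G2 -> T}),
    is_pro_p p T -> continuous g1 -> continuous g2 -> g1 \o f1 =1 g2 \o f2 ->
    (exists u : {multiplicative P -> T},
      [/\ continuous u, u \o j1 =1 g1 & u \o j2 =1 g2]) /\
    (forall u v : {multiplicative P -> T}, continuous u -> continuous v ->
      u \o j1 =1 v \o j1 -> u \o j2 =1 v \o j2 -> u =1 v)].

Record pNormal (p : nat) (G : groupType) := PNormal {
  pnormal :> normalSubgroup G;
  pnormalP : p_index p pnormal }.
HB.instance Definition _ p G := gen_eqMixin (pNormal p G).
HB.instance Definition _ p G := gen_choiceMixin (pNormal p G).

Section Completion.
Variables (p : nat) (G : groupType).

(* The inverse limit of the quotients of p-power index, realized as the set of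
   families that are compatible with the projections G / N -> G / M. *)
Record completion := Completion {
  component :> forall N : pNormal p G, quot N;
  componentP : forall N M : pNormal p G, normal_set N `<=` normal_set M ->
    forall x, component N = quot_proj N x -> component M = quot_proj M x }.

HB.instance Definition _ := gen_eqMixin completion.
HB.instance Definition _ := gen_choiceMixin completion.

Lemma completionP (a b : completion) : (forall N, a N = b N) -> a = b.
Proof.
case: a b => [a aP] [b bP] /= ab.
have e : a = b by apply: functional_extensionality_dep.
by case: _ / e in bP *; congr Completion; exact: Prop_irrelevance.
Qed.

Definition to_completion (x : G) : completion.
Proof.
refine (@Completion (fun N => quot_proj N x) _).
by move=> N M NM y /quot_projP/NM Mxy; apply/quot_projP.
Defined.

Definition completion_mul (a b : completion) : completion.
Proof.
refine (@Completion (fun N => a N * b N) _) => N M NM z.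
have [x ax] := quot_proj_surj (a N); have [y bY] := quot_proj_surj (b N).
rewrite ax bY (componentP NM ax) (componentP NM bY) -!gmulfM.
by move=> /quot_projP/NM/quot_projP.
Defined.

Fact quot_projV (N : normalSubgroup G) (x : G) :
  (quot_proj N x)^-1 = quot_proj N x^-1.
Proof. exact: quot_invE. Qed.

Definition completion_inv (a : completion) : completion.
Proof.
refine (@Completion (fun N => (a N)^-1) _) => N M NM z.
have [x ax] := quot_proj_surj (a N).
by rewrite ax (componentP NM ax) !quot_projV => /quot_projP/NM/quot_projP.
Defined.

Fact completion_mulA : associative completion_mul.
Proof. by move=> a b c; apply: completionP => N /=; rewrite mulgA. Qed.
Fact completion_mul1 : left_id (to_completion 1) completion_mul.
Proof. by move=> a; apply: completionP => N /=; exact: mul1g. Qed.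
Fact completion_1mul : right_id (to_completion 1) completion_mul.
Proof. by move=> a; apply: completionP => N /=; exact: mulg1. Qed.
Fact completion_mulV :
  left_inverse (to_completion 1) completion_inv completion_mul.
Proof. by move=> a; apply: completionP => N /=; exact: mulVg. Qed.
Fact completion_Vmul :
  right_inverse (to_completion 1) completion_inv completion_mul.
Proof. by move=> a; apply: completionP => N /=; exact: mulgV. Qed.

HB.instance Definition _ := isGroup.Build completion completion_mulA
  completion_mul1 completion_1mul completion_mulV completion_Vmul.

Fact to_completion_is_multiplicative : {morph to_completion : x y / x * y}.
Proof. by move=> x y; apply: completionP => N /=; rewrite gmulfM. Qed.
HB.instance Definition _ := isMultiplicative.Build G completion to_completion
  to_completion_is_multiplicative.

(* The topology induced by the product of the discrete quotients. *)
Definition to_prod (a : completion) :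
    prod_topology (fun N : pNormal p G => discrete_topology (quot N)) :=
  component a.

HB.instance Definition _ :=
  Topological.copy completion (initial_topology to_prod).

Lemma nbhs_component (a : completion) (N : pNormal p G) :
  nbhs a [set b : completion | b N = a N].
Proof.
pose T (M : pNormal p G) := discrete_topology (quot M).
have aN : nbhs (to_prod a) [set y : prod_topology T | y N = a N].
  have := @proj_continuous _ T N (to_prod a) [set a N]; apply.
  exact: (@discrete_set1 (T N)).
exact: (@initial_continuous completion _ to_prod a _ aN).
Qed.

Lemma cvg_completion (F : set_system completion) (a : completion) :
  Filter F -> (forall N, F [set b : completion | b N = a N]) -> F --> a.
Proof.
move=> FF Fa A [/= _ [[B Bop <-] Ba] BA].
apply: filterS BA _; change ((to_prod @ F) B).
suff : to_prod @ F --> to_prod a by apply; exact: open_nbhs_nbhs.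
apply/cvg_sup => N C [/= _ [[D Dop <-] Da] DC].
change (F (to_prod @^-1` C)); apply: (filterS _ (Fa N)) => b bN; apply: DC.
by rewrite /= /to_prod bN.
Qed.

Fact completion_mulg_continuous :
  continuous (fun ab : completion * completion => ab.1 * ab.2).
Proof.
move=> [a b]; apply: (@cvg_completion (_ @ _)) => N.
exists ([set c : completion | c N = a N], [set c : completion | c N = b N]).
  by split; exact: nbhs_component.
by move=> [c d] /= [-> ->].
Qed.

Fact completion_invg_continuous : continuous (fun a : completion => a^-1).
Proof.
move=> a; have FF := @fmap_filter _ _ (fun b : completion => b^-1) _ (nbhs_filter a).
apply: (cvg_completion FF) => N.
apply: (@filterS _ (nbhs a) _ _ _ _ (nbhs_component a N)) => b.
by rewrite /= => ->.
Qed.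

HB.instance Definition _ := isTopGroup.Build completion
  completion_mulg_continuous completion_invg_continuous.

End Completion.

Section MultiplicativeTheory.
Variables (G H : groupType) (f : {multiplicative G -> H}).

Lemma multiplicative1 : f 1 = 1.
Proof. by apply: (@mulgI _ (f 1)); rewrite -gmulfM !mulg1. Qed.

Lemma multiplicativeV x : f x^-1 = (f x)^-1.
Proof. by apply: (@mulgI _ (f x)); rewrite -gmulfM !mulgV multiplicative1. Qed.

End MultiplicativeTheory.

Section CompletionMap.
Variables (p : nat) (G H : groupType) (f : {multiplicative G -> H}).

Fact preimage_is_normal (N : normalSubgroup H) : is_normal (f @^-1` N).
Proof.
case: N => N [[N1 NM] NJ]; split; last first.
  by move=> x g /= /(NJ _ (f g)); rewrite !conjgE !gmulfM multiplicativeV.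
split=> [|x y /= Nx Ny]; first by rewrite /= multiplicative1.
by rewrite gmulfM multiplicativeV; exact: NM.
Qed.

Definition preimage_normal (N : normalSubgroup H) : normalSubgroup G :=
  NormalSubgroup (preimage_is_normal N).

Fact preimage_p_index (N : pNormal p H) : p_index p (preimage_normal N).
Proof.
case: N => N [P [phi [pP phi_inj phi_surj]]] /=.
pose im y x := phi y = quot_proj N (f x).
have imM y x y' x' : im y x -> im y' x' -> im (y * y') (x * x').
  by rewrite /im => yx yx'; rewrite gmulfM yx yx' -gmulfM /= -gmulfM.
have im_ker y x x' : im y x -> im y x' ->
    quot_proj (preimage_normal N) x = quot_proj (preimage_normal N) x'.
  rewrite /im => -> /quot_projP Nxx'; apply/quot_projP => /=.
  by rewrite gmulfM multiplicativeV.
pose A := [set y : P | `[< exists x, im y x >]]%SET.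
have gA : group_set A.
  apply/group_setP; split=> [|y z]; rewrite !inE.
    exists 1; rewrite /im (multiplicative1 f) (multiplicative1 phi).
    by rewrite (multiplicative1 (quot_proj N)).
  by move=> [x yx] [x' zx']; exists (x * x'); exact: imM.
pose B := fingroup.group gA.
have sec (u : subg_of B) : exists x, im (sgval u) x.
  by have := subgP u; rewrite !inE.
pose sec' u := projT1 (cid (sec u)).
have sec'P u : im (sgval u) (sec' u) := projT2 (cid (sec u)).
pose g u := quot_proj (preimage_normal N) (sec' u).
have gM : {morph g : u v / u * v}.
  move=> u v; rewrite /g -gmulfM; apply: (im_ker (sgval u * sgval v)).
    exact: (sec'P (u * v)).
  exact: imM.
pose gm := isMultiplicative.Build _ _ g gM.
pose gh : {multiplicative subg_of B -> quot (preimage_normal N)} :=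
  HB.pack g gm.
exists (subg_of B : finGroupType), gh; split.
- by rewrite /pgroup -(card_isog (isog_subg B)); exact: (pgroupS (finset.subsetT B)).
- move=> u v /= /quot_projP /= Nuv; apply/subg_inj/phi_inj.
  rewrite (sec'P u) (sec'P v); apply/quot_projP.
  by move: Nuv; rewrite gmulfM multiplicativeV.
- apply/seteqP; split=> // a _; have [x ->] := quot_proj_surj a.
  have [y _ yx] : range phi (quot_proj N (f x)) by rewrite phi_surj.
  have By : y \in B by rewrite !inE; exists x.
  by exists (Subg By) => //; exact: im_ker (sec'P (Subg By)) yx.
Qed.

Definition preimage_pnormal (N : pNormal p H) : pNormal p G :=
  PNormal (preimage_p_index N).

(* The component at N of the image of [a] is the image of the component of [a]
   at the preimage of N under G / f^-1(N) -> H / N. *)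
Definition completion_map_component (a : completion p G) (N : pNormal p H) :
  quot N := quot_proj N (f (repr (a (preimage_pnormal N)))).

Lemma completion_map_componentE (a : completion p G) (N : pNormal p H) (x : G) :
  a (preimage_pnormal N) = quot_proj _ x ->
  completion_map_component a N = quot_proj N (f x).
Proof.
move=> ax; apply/quot_projP; rewrite -multiplicativeV -gmulfM.
by apply/(quot_projP (preimage_normal N)); rewrite -ax /quot_proj reprK.
Qed.

Definition completion_map (a : completion p G) : completion p H.
Proof.
refine (@Completion p H (completion_map_component a) _) => N M NM y.
have [x ax] := quot_proj_surj (a (preimage_pnormal N)).
have fNM : normal_set (preimage_pnormal N) `<=` preimage_pnormal M.
  by move=> z; exact: NM.
rewrite (completion_map_componentE ax).
rewrite (completion_map_componentE (componentP fNM ax)).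
by move=> /quot_projP/NM/quot_projP.
Defined.

Fact completion_map_is_multiplicative : {morph completion_map : a b / a * b}.
Proof.
move=> a b; apply: completionP => N /=.
have [x ax] := quot_proj_surj (a (preimage_pnormal N)).
have [y bY] := quot_proj_surj (b (preimage_pnormal N)).
rewrite (completion_map_componentE ax) (completion_map_componentE bY).
have abxy : (a * b) (preimage_pnormal N) = quot_proj _ (x * y).
  by rewrite quot_proj_is_multiplicative; move: ax bY => /= <- <-.
by rewrite (completion_map_componentE abxy) !gmulfM.
Qed.
HB.instance Definition _ := isMultiplicative.Build _ _ completion_map
  completion_map_is_multiplicative.

Lemma completion_map_natural x :
  completion_map (to_completion p x) = to_completion p (f x).
Proof. by apply: completionP => N; exact: completion_map_componentE. Qed.

Lemma completion_map_continuous : continuous completion_map.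
Proof.
move=> a; have FF := @fmap_filter _ _ completion_map _ (nbhs_filter a).
apply: (cvg_completion FF) => N.
apply: (@filterS _ (nbhs a) _ _ _ _ (nbhs_component a (preimage_pnormal N))).
by move=> b /= ab; rewrite /completion_map_component ab.
Qed.

End CompletionMap.

Arguments completion_map p {G H} f a.

(* Main.v *)
Require Import Defs.
From HB Require Import structures.
From mathcomp Require Import fingroup morphism perm quotient gproduct pgroup.
From mathcomp Require Import all_boot all_order.
From mathcomp Require Import all_classical topology.

(** Write G^ for the pro-p completion of G. The group Gamma^, with the maps
    H_i^ -> Gamma^, is always a pro-p pushout of H_1^ <- K^ -> H_2^: continuous
    homomorphisms from G^ to a pro-p group T are the same as homomorphisms from
    G to T, so the universal property of Gamma among abstract groups turns into
    the one of Gamma^ among pro-p groups ([completion_pushout]). Hence any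
    pro-p pushout is canonically isomorphic to Gamma^
    ([pro_p_pushout_unique]), and what remains is the injectivity of
    K^ -> H_i^ and H_i^ -> Gamma^. A map G^ -> H^ is injective as soon as each
    normal subgroup of p-power index of G contains the preimage of one of H
    ([completion_map_inj]). Since the L in the given family are cofinal in K,
    it suffices to find, for each such L, a homomorphism from Gamma to a finite
    p-group whose kernel meets each H_i within L ([amalgam_to_pgroup]).

    That homomorphism is explicit. Put C = K / L and Q = H_1 / K x H_2 / K, and
    let A be the p-group of automorphisms of C generated by the conjugations.
    Choose a transversal of K in H_1. Then H_1 is, as a set with a K-action by
    left multiplication, K x (H_1 / K), and in these coordinates h in H_1 acts
    by (c, y) |-> (h c h^-1 . gamma_h(y), h y) with gamma_h(y) in K. Reducing
    modulo L and letting H_1 act trivially on the other factor of Q gives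
    permutations of C x Q of the form (c, y) |-> (a(c) gamma(y), q y) with a in
    A, gamma : Q -> C and q in Q. All permutations of this form make up the
    semidirect product of C^Q by A x Q, a finite p-group ([wreath_pgroup]). The
    same recipe applies to H_2, and on K both give the left multiplications
    (c, y) |-> (k c, y), whatever the transversals; so they glue to a
    homomorphism on Gamma.

    The extension of homomorphisms from G to G^ rests on the fact that the open
    normal subgroups of a compact Hausdorff totally disconnected group form a
    base of neighborhoods of 1 ([open_normal_subgroup_in]). *)

Set Implicit Arguments.
Unset Strict Implicit.
Unset Printing Implicit Defensive.

Local Open Scope classical_set_scope.
Local Open Scope group_scope.

(** * Normal subgroups of p-power index *)

Definition morph_hom (G H : groupType) (f : G -> H)
    (fM : {morph f : x y / x * y}) :
  {multiplicative G -> H} := HB.pack f (isMultiplicative.Build G H f fM).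

Section PIndex.
Variables (p : nat) (G : groupType).
Implicit Types N M : normalSubgroup G.

Lemma p_index_hom N : p_index p N ->
  exists (W : finGroupType) (f : {multiplicative G -> W}),
    [/\ p.-group [set: W]%SET, (forall x, f x = 1 <-> normal_set N x) &
        forall w, exists x, f x = w].
Proof.
move=> [W [phi [pW phi_inj phi_surj]]].
have sec x : exists w, phi w = quot_proj N x.
  have : [set: quot N] (quot_proj N x) by [].
  by rewrite -phi_surj => -[w _ <-]; exists w.
pose f x := projT1 (cid (sec x)).
have fE x : phi (f x) = quot_proj N x := projT2 (cid (sec x)).
have fM : {morph f : x y / x * y}.
  by move=> x y; apply: phi_inj; rewrite gmulfM !fE -gmulfM.
exists W, (morph_hom fM); split=> //=.
- move=> x; have -> : f x = 1 <-> quot_proj N 1 = quot_proj N x.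
    rewrite -(fE x) (multiplicative1 (quot_proj N)) -(multiplicative1 phi).
    by split=> [->//|/phi_inj].
  by rewrite quot_projP invg1 mul1g.
- move=> w; have [x wx] := quot_proj_surj (phi w).
  by exists x; apply: phi_inj; rewrite fE.
Qed.

(** The quotient G / N is the quotient of the image of f by the image of N. *)
Lemma p_index_kernel (W : finGroupType) (f : {multiplicative G -> W}) N :
  p.-group [set: W]%SET -> (forall x, f x = 1 -> normal_set N x) ->
  p_index p N.
Proof.
move=> pW kerN; have [N1 NM] := (normal_setP N).1; have NJ := (normal_setP N).2.
pose B := [set w : W | `[< exists x, f x = w >]]%SET.
have gB : group_set B.
  apply/group_setP; split=> [|v w]; rewrite !inE.
    by exists 1; rewrite multiplicative1.
  by move=> [x <-] [y <-]; exists (x * y); rewrite gmulfM.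
pose A := [set w : W | `[< exists2 x, f x = w & normal_set N x >]]%SET.
have gA : group_set A.
  apply/group_setP; split=> [|v w]; rewrite !inE.
    by exists 1; rewrite ?multiplicative1.
  move=> [x <- Nx] [y <- Ny]; exists (x * y); rewrite ?gmulfM //.
  exact: is_subgroupM (normal_setP N).1 _ _ Nx Ny.
pose Bg := group gB; pose Ag := group gA.
have memA x : (f x \in A) = `[< normal_set N x >].
  rewrite inE; apply/asboolP/asboolP => [[y fxy Ny]|Nx]; last by exists x.
  have /kerN : f (y^-1 * x) = 1.
    by rewrite gmulfM multiplicativeV fxy mulVg.
  by move=> /(is_subgroupM (normal_setP N).1 Ny); rewrite mulVKg.
have nA x : f x \in 'N(Ag).
  rewrite inE; apply/fintype.subsetP => _ /imsetP[w + ->].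
  rewrite !inE => -[y <- Ny]; exists (y ^ x); last exact: NJ.
  by rewrite !conjgE !gmulfM multiplicativeV.
have cosetE x y : (coset Ag (f x) == coset Ag (f y)) =
    `[< quot_proj N x = quot_proj N y >].
  have -> : `[< quot_proj N x = quot_proj N y >] =
      `[< normal_set N (x^-1 * y) >].
    by apply: asbool_equiv_eq; exact: quot_projP.
  rewrite -memA gmulfM multiplicativeV.
  rewrite eq_mulVg1 -morphV // -morphM ?groupV //=.
  have nxy : (f x)^-1 * f y \in 'N(Ag) by rewrite groupM ?groupV.
  by apply/eqP/idP => [/(coset_idr nxy)|/coset_id].
have sec (u : subg_of (Bg / Ag)%G) : exists x, coset Ag (f x) = sgval u.
  have /morphimP[w _ Bw ->] := subgP u.
  by move: Bw; rewrite inE => /asboolP[x <-]; exists x.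
pose s u := projT1 (cid (sec u)).
have sE u : coset Ag (f (s u)) = sgval u := projT2 (cid (sec u)).
pose g u := quot_proj N (s u).
have gE u x : coset Ag (f x) = sgval u -> g u = quot_proj N x.
  by rewrite -sE => /esym/eqP; rewrite cosetE => /asboolP.
have gM : {morph g : u v / u * v}.
  move=> u v; rewrite /g -gmulfM; apply: gE.
  by rewrite gmulfM morphM //= !sE.
exists (subg_of (Bg / Ag)%G), (morph_hom gM).
split=> /=.
- rewrite /pgroup -(card_isog (isog_subg (Bg / Ag)%G)).
  have pB : p.-group Bg := pgroupS (finset.subsetT _) pW.
  exact: quotient_pgroup pB.
- move=> u v /asboolP; rewrite -cosetE !sE => /eqP.
  exact: subg_inj.
- apply/seteqP; split=> // a _; have [x ->] := quot_proj_surj a.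
  have BAx : coset Ag (f x) \in (Bg / Ag)%G.
    by apply: mem_quotient; rewrite inE; apply/asboolP; exists x.
  by exists (Subg BAx) => //; exact: gE.
Qed.

Lemma p_index_inter N M : p_index p N -> p_index p M ->
  exists2 L : pNormal p G, normal_set L `<=` normal_set N &
                           normal_set L `<=` normal_set M.
Proof.
move=> /p_index_hom[W [f [pW fN _]]] /p_index_hom[V [g [pV gM _]]].
have IP : is_normal (normal_set N `&` normal_set M).
  have [Ns NJ] := normal_setP N; have [Ms MJ] := normal_setP M.
  split; last by move=> x y [/NJ Nx /MJ Mx]; split.
  split=> [|x y [Nx Mx] [Ny My]]; first by split; [exact: Ns.1|exact: Ms.1].
  by split; [exact: Ns.2|exact: Ms.2].
pose h x := (f x, g x).
have hM : {morph h : x y / x * y} by move=> x y; rewrite /h !gmulfM.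
have pI : p_index p (NormalSubgroup IP).
  apply: (@p_index_kernel _ (morph_hom hM)).
    by rewrite /pgroup cardsT card_prod pnatM -!cardsT; apply/andP.
  by move=> x [/fN Nx /gM Mx].
by exists (PNormal pI) => x [].
Qed.

End PIndex.

(** * The twisted wreath product *)

(** The triple (gamma, a, q) stands for the permutation
    (c, y) |-> (a(c) gamma(y), q y) of C x Q, where a acts on C through rho; the
    group law below is the composition of these permutations. *)
Definition wreath_of (C A Q : finGroupType) (rho : {multiplicative A -> aut C})
  : Type := ({ffun Q -> C} * A * Q)%type.

Section TwistedWreath.
Variables (C A Q : finGroupType) (rho : {multiplicative A -> aut C}).

Lemma aut_homM s t c : rho (s * t) c = rho s (rho t c).
Proof. by rewrite gmulfM. Qed.

Lemma aut_hom1 c : rho 1 c = c.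
Proof. by rewrite multiplicative1. Qed.

Notation wreath := (wreath_of Q rho).
HB.instance Definition _ := Finite.copy wreath ({ffun Q -> C} * A * Q)%type.

Definition wreath_mul (v w : wreath) : wreath :=
  ([ffun y => rho v.1.2 (w.1.1 y) * v.1.1 (w.2 * y)], v.1.2 * w.1.2, v.2 * w.2).
Definition wreath_one : wreath := ([ffun=> 1], 1, 1).
Definition wreath_inv (w : wreath) : wreath :=
  ([ffun y => (rho w.1.2^-1 (w.1.1 (w.2^-1 * y)))^-1], w.1.2^-1, w.2^-1).

Fact wreath_mulA : associative wreath_mul.
Proof.
move=> u v w; congr (_, _, _); rewrite /= ?mulgA //.
by apply/ffunP => y; rewrite !ffunE /= aut_morph aut_homM !mulgA.
Qed.

Fact wreath_mul1 : left_id wreath_one wreath_mul.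
Proof.
move=> [[g s] q]; congr (_, _, _); rewrite /= ?mul1g //.
by apply/ffunP => y; rewrite !ffunE aut_hom1 mulg1.
Qed.

Fact wreath_mulV : left_inverse wreath_one wreath_inv wreath_mul.
Proof.
move=> [[g s] q]; congr (_, _, _); rewrite /= ?mulVg //.
by apply/ffunP => y; rewrite !ffunE /= mulKg mulgV.
Qed.

HB.instance Definition _ :=
  Finite_isGroup.Build wreath wreath_mulA wreath_mul1 wreath_mulV.

Lemma wreath_mulE (v w : wreath) : v * w = wreath_mul v w. Proof. by []. Qed.

Lemma wreath_pgroup p : p.-group [set: C]%SET -> p.-group [set: A]%SET ->
  p.-group [set: Q]%SET -> p.-group [set: wreath]%SET.
Proof.
rewrite /pgroup !cardsT => pC pA pQ.
by rewrite !card_prod card_ffun !pnatM pnatX pC pA pQ.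
Qed.

End TwistedWreath.

Section Cocycle.
Variables (K H : groupType) (k : {multiplicative K -> H}).
Hypotheses (k_inj : injective k) (k_normal : is_normal (range k)).
Variables (C A Q : finGroupType) (rho : {multiplicative A -> aut C}).
Hypothesis rho_inj : injective rho.
Variable c : {multiplicative K -> C}.
Hypothesis c_surj : forall z, exists x, c x = z.
Hypothesis conj_rho : forall h : H, exists s : A,
  forall x y, k y = h * k x * h^-1 -> rho s (c x) = c y.
Variables (tau : {multiplicative H -> Q}) (sec : Q -> H).
Hypothesis tauk : forall x, tau (k x) = 1.
Hypothesis secP : forall h q, range k (h * sec q * (sec (tau h * q))^-1).

(** In the coordinates given by the section [sec], left multiplication by h in H
    becomes (c, y) |-> (h c h^-1 . gamma_h(y), tau(h) y), where the cocycle
    gamma_h(y) = h sec(y) sec(tau(h) y)^-1 lies in K. The three conclusions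
    show that on K the result depends neither on the section nor on H. *)
Lemma wreath_hom : exists f : {multiplicative H -> wreath_of Q rho},
  [/\ forall x q, (f (k x)).1.1 q = c x,
      forall x z, rho (f (k x)).1.2 (c z) = c (x * z * x^-1) &
      forall h, (f h).2 = tau h].
Proof.
(* The inverse of k on its range, extended by 1. *)
pose ki z : K := if pselect (range k z) is left kz then projT1 (cid2 kz) else 1.
have kiE z : range k z -> k (ki z) = z.
  by rewrite /ki; case: pselect => // kz _; case: (cid2 kz).
have kiK x : ki (k x) = x by apply: k_inj; rewrite kiE.
have kiM z w : range k z -> range k w -> ki (z * w) = ki z * ki w.
  by move=> [x _ <-] [y _ <-]; rewrite -gmulfM !kiK.
have kJ h z : range k z -> range k (h * z * h^-1).
  by move=> kz; have := k_normal.2 _ h^-1 kz; rewrite conjgE invgK mulgA.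
pose s h := projT1 (cid (conj_rho h)).
have sE h z : range k z -> rho (s h) (c (ki z)) = c (ki (h * z * h^-1)).
  move=> kz; apply: (projT2 (cid (conj_rho h))).
  by rewrite !kiE //; exact: kJ.
pose f h : wreath_of Q rho :=
  ([ffun q => c (ki (h * sec q * (sec (tau h * q))^-1))], s h, tau h).
have fM : {morph f : x y / x * y}.
  move=> g h; rewrite wreath_mulE; congr (_, _, _); last exact: gmulfM.
  - apply/ffunP => q; rewrite !ffunE /= sE // -gmulfM -kiM //; last exact: kJ.
    by congr (c (ki _)); rewrite gmulfM -!mulgA mulKg mulKg.
  - apply: rho_inj; apply: autP => z; have [x <-] := c_surj z.
    rewrite -(kiK x) aut_homM !sE //; first by rewrite invMg !mulgA.
    exact: kJ.
exists (morph_hom fM); split=> // [x q|x z].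
- by rewrite /= ffunE tauk mul1g mulgK kiK.
- by rewrite /= -{1}(kiK z) sE // -multiplicativeV -!gmulfM kiK.
Qed.

End Cocycle.

(** * Conjugation automorphisms *)

Lemma aut_transport (G H : groupType) (u : {multiplicative G -> H})
    (v : H -> G) :
  cancel u v -> cancel v u ->
  exists2 T : {multiplicative aut G -> aut H}, injective T &
    forall a x, T a (u x) = u (a x).
Proof.
move=> uK vK.
have TM (a : aut G) : {morph u \o a \o v : x y / x * y}.
  by move=> x y /=; rewrite (can2_gmulfM uK vK) aut_morph gmulfM.
have TK (a : aut G) : cancel (u \o a \o v) (u \o aut_inv a \o v).
  by move=> x /=; rewrite uK aut_funK vK.
have KT (a : aut G) : cancel (u \o aut_inv a \o v) (u \o a \o v).
  by move=> x /=; rewrite uK aut_invK vK.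
pose T a : aut H := Aut (TM a) (TK a) (KT a).
have TTM : {morph T : a b / a * b}.
  by move=> a b; apply: autP => x /=; rewrite uK.
exists (morph_hom TTM) => [a b ab|a x] /=; last by rewrite uK.
apply: autP => x; apply: (can_inj uK).
by move: (congr1 (fun t : aut H => t (u x)) ab); rewrite /= uK.
Qed.

Lemma aut_quot (K : groupType) (L : normalSubgroup K) (a : aut K) :
  is_characteristic (normal_set L) ->
  exists b : aut (quot L), forall x, b (quot_proj L x) = quot_proj L (a x).
Proof.
move=> [_ Lchar].
pose ext (e : aut K) (z : quot L) : quot L := quot_proj L (e (repr z)).
have extE (e : aut K) x : ext e (quot_proj L x) = quot_proj L (e x).
  apply/quot_projP.
  have eM : {morph e : y z / y * z} := aut_morph e.
  rewrite -(@multiplicativeV _ _ (morph_hom eM)) -eM; apply: Lchar.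
  by apply/quot_projP; rewrite /quot_proj reprK.
have eM (e : aut K) : {morph ext e : x y / x * y}.
  move=> z w; have [x ->] := quot_proj_surj z; have [y ->] := quot_proj_surj w.
  by rewrite -gmulfM !extE aut_morph gmulfM.
have aK : cancel (ext a) (ext (a^-1)).
  by move=> z; have [x ->] := quot_proj_surj z; rewrite !extE /= aut_funK.
have Ka : cancel (ext (a^-1)) (ext a).
  by move=> z; have [x ->] := quot_proj_surj z; rewrite !extE /= aut_invK.
by exists (Aut (eM a) aK Ka) => x; exact: extE.
Qed.

Section Conjugation.
Variables (K H : groupType) (k : {multiplicative K -> H}).
Hypotheses (k_inj : injective k) (k_normal : is_normal (range k)).

Lemma conj_aut h : exists a : aut K, forall x, k (a x) = k x ^ h.
Proof.
have ex g x : exists y, k y = k x ^ g.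
  by have [|y _] := k_normal.2 (k x) g; [exists x|exists y].
pose c g x := projT1 (cid (ex g x)).
have cE g x : k (c g x) = k x ^ g := projT2 (cid (ex g x)).
have cM : {morph c h : x y / x * y}.
  by move=> x y; apply: k_inj; rewrite gmulfM !cE gmulfM conjMg.
have cK : cancel (c h) (c h^-1).
  by move=> x; apply: k_inj; rewrite !cE conjgK.
have Kc : cancel (c h^-1) (c h).
  by move=> x; apply: k_inj; rewrite !cE conjgKV.
by exists (Aut cM cK Kc) => x; exact: cE.
Qed.

Lemma conj_induced (L : normalSubgroup K) h :
  is_characteristic (normal_set L) ->
  exists a : aut (quot L), induced_by_conj k h a.
Proof.
move=> Lchar; have [a aE] := conj_aut h; have [b bE] := aut_quot a Lchar.
exists b => x y kxy; rewrite bE; congr quot_proj.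
by apply: k_inj; rewrite aE kxy.
Qed.

End Conjugation.

Lemma transversal (H : groupType) (Q : finGroupType)
    (t : {multiplicative H -> Q}) (R : set H) :
  (forall h, t h = 1 <-> R h) -> (forall q, exists h, t h = q) ->
  exists s : Q -> H, forall h q, R (h * s q * (s (t h * q))^-1).
Proof.
move=> tR t_surj; exists (fun q => projT1 (cid (t_surj q))) => h q.
case: (cid (t_surj q)) => g /= tg; case: (cid _) => g' /= tg'.
by apply/tR; rewrite !gmulfM multiplicativeV tg' tg mulgV.
Qed.

(** * A finite p-quotient of the amalgam *)

Section Amalgam.
Variables (p : nat) (K H1 H2 Gamma : groupType)
  (k1 : {multiplicative K -> H1}) (k2 : {multiplicative K -> H2})
  (i1 : {multiplicative H1 -> Gamma}) (i2 : {multiplicative H2 -> Gamma}).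
Hypotheses (k1_inj : injective k1) (k2_inj : injective k2)
  (Gamma_amalgam : is_group_pushout k1 k2 i1 i2)
  (K_normal1 : is_normal (range k1)) (K_normal2 : is_normal (range k2))
  (K_index1 : p_index p (NormalSubgroup K_normal1))
  (K_index2 : p_index p (NormalSubgroup K_normal2)).
Variable L : normalSubgroup K.
Hypotheses (L_char : is_characteristic (normal_set L)) (L_index : p_index p L)
  (L_action : is_finite_pgroup p
    (generated_subgroup (conj_action k1 L `|` conj_action k2 L))).

(** The subgroup N is the kernel of the map from Gamma to the twisted wreath
    product obtained by gluing [wreath_hom] for H_1 and for H_2. An element of
    H_i in N is trivial in Q, hence lies in K, and then trivial in K / L. *)
Lemma amalgam_to_pgroup :
  exists N : pNormal p Gamma,
    (forall h, normal_set N (i1 h) -> exists2 x, h = k1 x & normal_set L x) /\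
    (forall h, normal_set N (i2 h) -> exists2 x, h = k2 x & normal_set L x).
Proof.
have [C [c [pC cL c_surj]]] := p_index_hom L_index.
have [Q1 [t1 [pQ1 t1k t1_surj]]] := p_index_hom K_index1.
have [Q2 [t2 [pQ2 t2k t2_surj]]] := p_index_hom K_index2.
have [A [iota [pA iota_inj iotaE]]] := L_action.
pose u (z : quot L) : C := c (repr z).
have uE x : u (quot_proj L x) = c x.
  apply: (mulgI (u (quot_proj L x))^-1); rewrite mulVg -multiplicativeV -gmulfM.
  apply/esym/cL; apply/quot_projP.
  by rewrite /quot_proj reprK.
have uM : {morph u : y z / y * z}.
  move=> y z; have [x ->] := quot_proj_surj y; have [x' ->] := quot_proj_surj z.
  by rewrite -gmulfM !uE gmulfM.
have [v vc] : exists v, forall x, v (c x) = quot_proj L x.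
  exists (fun z => quot_proj L (projT1 (cid (c_surj z)))) => x.
  case: cid => y /= cyx; apply/quot_projP/cL.
  by rewrite gmulfM multiplicativeV cyx mulVg.
have uK : cancel u v.
  by move=> z; have [x ->] := quot_proj_surj z; rewrite uE vc.
have vK : cancel v u.
  by move=> z; have [x <-] := c_surj z; rewrite vc uE.
have [T T_inj TE] := @aut_transport _ _ (morph_hom uM) v uK vK.
pose rho : {multiplicative A -> aut C} := T \o iota.
have rho_inj : injective rho by exact: inj_comp.
have rho_conj (a : aut (quot L)) : conj_action k1 L a \/ conj_action k2 L a ->
    exists s, forall x, rho s (c x) = u (a (quot_proj L x)).
  move=> act; have [s _ sa] : range iota a.
    by rewrite iotaE => S [_]; apply.
  by exists s => x; rewrite -uE /rho /= (TE (iota s)) /= sa.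
have conj_rho (H : groupType) (k : {multiplicative K -> H}) :
    injective k -> is_normal (range k) ->
    conj_action k L `<=` conj_action k1 L `|` conj_action k2 L ->
    forall h, exists s, forall x y, k y = h * k x * h^-1 -> rho s (c x) = c y.
  move=> k_inj k_normal k_act h.
  (* [induced_by_conj] is conjugation on the right, by h^-1 k h. *)
  have [a aE] := conj_induced k_inj k_normal h^-1 L_char.
  have [|s sE] := rho_conj a; first by apply: k_act; exists h^-1.
  by exists s => x y kxy; rewrite sE (aE x y) ?uE // kxy conjgE invgK mulgA.
have conj1 := conj_rho _ _ k1_inj K_normal1 (@subsetUl _ _ _).
have conj2 := conj_rho _ _ k2_inj K_normal2 (@subsetUr _ _ _).
have [s1 s1P] := transversal t1k t1_surj.
have [s2 s2P] := transversal t2k t2_surj.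
pose Q : finGroupType := (Q1 * Q2)%type.
have tau1M : {morph (fun h => (t1 h, 1) : Q) : x y / x * y}.
  by move=> x y; congr (_, _); rewrite ?gmulfM ?mulg1.
have tau2M : {morph (fun h => (1, t2 h) : Q) : x y / x * y}.
  by move=> x y; congr (_, _); rewrite ?gmulfM ?mulg1.
have t1k1 x : (t1 (k1 x), 1) = 1 :> Q.
  by congr (_, _); apply/t1k; exists x.
have t2k2 x : (1, t2 (k2 x)) = 1 :> Q.
  by congr (_, _); apply/t2k; exists x.
have [f1 [f1c f1r f1t]] := @wreath_hom _ _ _ k1_inj K_normal1 _ _ Q _ rho_inj _
  c_surj conj1 (morph_hom tau1M) (fun q => s1 q.1) t1k1 (fun h q => s1P h q.1).
have [f2 [f2c f2r f2t]] := @wreath_hom _ _ _ k2_inj K_normal2 _ _ Q _ rho_inj _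
  c_surj conj2 (morph_hom tau2M) (fun q => s2 q.2) t2k2 (fun h q => s2P h q.2).
have f12 : f1 \o k1 =1 f2 \o k2.
  move=> x /=; rewrite [LHS]surjective_pairing [RHS]surjective_pairing.
  rewrite [(f1 _).1]surjective_pairing [(f2 _).1]surjective_pairing.
  congr (_, _, _).
  - by apply/ffunP => q; rewrite f1c f2c.
  - apply: rho_inj; apply: autP => z; have [y <-] := c_surj z.
    by rewrite f1r f2r.
  - by rewrite f1t f2t; exact: etrans (t1k1 x) (esym (t2k2 x)).
have [[F [F1 F2]] _] := Gamma_amalgam.2 _ f1 f2 f12.
have kerP : is_normal [set g | F g = 1].
  split=> [|x g /= Fx]; last first.
    by rewrite conjgE !gmulfM multiplicativeV Fx mul1g mulVg.
  split=> [|x y /= Fx Fy]; first exact: multiplicative1.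
  by rewrite gmulfM multiplicativeV Fx Fy invg1 mulg1.
have pker : p_index p (NormalSubgroup kerP).
  apply: (@p_index_kernel _ _ _ F) => //.
  apply: wreath_pgroup => //.
  by rewrite /pgroup cardsT card_prod pnatM -!cardsT; apply/andP.
exists (PNormal pker); split=> h /= Fh.
- have f1h : f1 h = 1 by rewrite -F1.
  have [x _ kx] : range k1 h.
    by apply/t1k; have := congr1 (fun w => w.2.1) f1h; rewrite f1t.
  exists x => //; apply/cL; rewrite -(f1c x 1) kx f1h; exact: ffunE.
- have f2h : f2 h = 1 by rewrite -F2.
  have [x _ kx] : range k2 h.
    by apply/t2k; have := congr1 (fun w => w.2.2) f2h; rewrite f2t.
  exists x => //; apply/cL; rewrite -(f2c x 1) kx f2h; exact: ffunE.
Qed.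

End Amalgam.

(** * Open normal subgroups of profinite groups *)

(** The quasi-component Q of x, the intersection of the clopen sets containing
    x, is connected in a compact Hausdorff space. If Q splits into disjoint
    closed sets, normality puts them into disjoint open sets O and V; by
    compactness a single clopen set E containing x lies in O and V together, so
    both traces of E are clopen, and Q lies in the one that contains x. *)
Lemma compact_totally_disconnected_zero_dimensional (T : topologicalType) :
  compact [set: T] -> hausdorff_space T -> totally_disconnected [set: T] ->
  zero_dimensional T.
Proof.
move=> cT hT tdT x y xNy; apply: contrapT => noU.
pose clo := [set D : set T | D x /\ clopen D].
pose Q := \bigcap_(D in clo) D.
have Qx : Q x by move=> D [].
have Qy : Q y.
  move=> D [Dx Dclo]; apply: contrapT => nDy; apply: noU.
  by exists D.
have Qcl : closed Q by apply: closed_bigI => D [_ []].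
suff Qconn : connected Q.
  have : connected_component [set: T] x y by exists Q.
  by rewrite tdT // => /esym/eqP; rewrite (negPf xNy).
move=> B [b Bb] [C Cop BC] [D Dcl BD].
have Bcl : closed B by rewrite BD; exact: closedI.
have QBcl : closed (Q `\` B).
  have -> : Q `\` B = Q `&` ~` C.
    rewrite BC; apply/seteqP; split=> z [Qz nz]; split=> //.
      by move=> Cz; apply: nz.
    by case.
  by apply: closedI => //; exact: open_closedC.
have BnQB : set_nbhs B (~` (Q `\` B)).
  apply/set_nbhsP; exists (~` (Q `\` B)); split=> //; first exact: closed_openC.
  by move=> z Bz [_]; apply.
have [U /set_nbhsP[O [Oop BO OU]] UQB] := compact_normal hT cT Bcl BnQB.
pose V := ~` closure U.
have Vop : open V by apply: closed_openC; exact: closed_closure.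
have OV z : O z -> ~ V z by move=> /OU/subset_closure Uz; apply.
have QOV z : Q z -> O z \/ V z.
  move=> Qz; have [/BO|nBz] := pselect (B z); first by left.
  by right => /UQB; apply.
have [E [Ex Eclo] EOV] : exists2 E, clo E & E `<=` O `|` V.
  apply: contrapT => noE.
  pose F := filter_from clo (fun E => E `\` (O `|` V)).
  have FF : ProperFilter F.
    apply: filter_from_proper; last first.
      move=> E cE; apply: contrapT => /nonemptyPn E0; apply: noE.
      by exists E => //; rewrite -setD_eq0.
    apply: filter_from_filter; first by exists setT; split=> //; exact: clopenT.
    move=> E E' [Ex Ec] [E'x E'c]; exists (E `&` E').
      by split=> //; exact: clopenI.
    by move=> z [[]].
  have [|z [_ zF]] := cT F FF.
    by exists setT => //; split=> //; exact: clopenT.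
  have Qz : Q z.
    move=> E [Ex [Eop Ecl]]; apply: contrapT => nEz.
    have FE : F E by exists E => // w [].
    have nE : nbhs z (~` E).
      by apply: open_nbhs_nbhs; split=> //; exact: closed_openC.
    by have [w []] := zF E (~` E) FE nE.
  have Fn : F (~` (O `|` V)).
    by exists setT; [split=> //; exact: clopenT|move=> w []].
  have OVz : nbhs z (O `|` V).
    by apply: open_nbhs_nbhs; split; [exact: openU|exact: QOV].
  by have [w []] := zF _ _ Fn OVz.
have EO : E `&` O = E `&` ~` V.
  apply/seteqP; split=> z [Ez] Oz; split=> //; first exact: OV.
  by have [|/Oz] := EOV z Ez.
have EV : E `&` V = E `&` ~` O.
  apply/seteqP; split=> z [Ez] Oz; split=> //; first by move=> /OV.
  by have [/Oz|] := EOV z Ez.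
have [Ox|Vx] := QOV x Qx.
- have QEO : Q `<=` E `&` O.
    move=> z; apply; split=> //; split.
      by apply: openI => //; case: Eclo.
    rewrite EO; apply: closedI; first by case: Eclo.
    exact: open_closedC.
  apply/seteqP; split=> z; first by rewrite BC => -[].
  move=> Qz; apply: contrapT => nBz; have [_ Oz] := QEO z Qz.
  by have /UQB := subset_closure (OU z Oz); apply.
- have QEV : Q `<=` E `&` V.
    move=> z; apply; split=> //; split.
      by apply: openI => //; case: Eclo.
    rewrite EV; apply: closedI; first by case: Eclo.
    exact: open_closedC.
  have Qb : Q b by move: Bb; rewrite BC => -[].
  by have [_ /(OV _ (BO _ Bb))] := QEV b Qb.
Qed.

Section TopGroup.
Variable T : topGroupType.

Lemma mulg_left_continuous (x : T) : continuous (fun y => x * y).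
Proof.
move=> y; apply: (@cvg_comp _ _ _ (fun z => (x, z)) (fun xy => xy.1 * xy.2));
  last exact: (mulg_continuous (x, y)).
by apply: cvg_pair; [exact: cvg_cst|exact: cvg_id].
Qed.

Lemma translate_nbhs (x : T) (A : set T) :
  nbhs 1 A -> nbhs x [set y | A (x^-1 * y)].
Proof.
move=> A1; have := @mulg_left_continuous x^-1 x A.
by rewrite mulVg; apply.
Qed.

Lemma subgroup_open (N : set T) : is_subgroup N -> nbhs 1 N -> open N.
Proof.
move=> sN N1; rewrite openE => x Nx; rewrite /interior.
apply: filterS (translate_nbhs x N1) => y /=.
by move=> /(is_subgroupM sN Nx); rewrite mulKVg.
Qed.

(** Take a clopen U with 1 in U contained in A. The x such that g x h and g h
    are always on the same side of U form a normal subgroup, contained in U as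
    g = h = 1 shows. It is open because the condition holds near (g, h, 1) for
    each (g, h), and T x T is compact. *)
Lemma open_normal_subgroup_in (A : set T) :
  compact [set: T] -> hausdorff_space T -> totally_disconnected [set: T] ->
  nbhs 1 A -> exists2 N : normalSubgroup T, open (normal_set N) &
                   normal_set N `<=` A.
Proof.
move=> cT hT tdT A1.
have zT := compact_totally_disconnected_zero_dimensional cT hT tdT.
have [U [U1 [Uop Ucl]] UA] := zero_dimensional_cvg hT zT cT A1.
pose N := [set x : T | forall g h, U (g * x * h) <-> U (g * h)].
have NP : is_normal N.
  split=> [|x k Nx g h].
    split=> [g h|x y Nx Ny g h]; first by rewrite mulg1.
    by rewrite !mulgA Ny -(Nx _ h) mulgVK.
  by rewrite conjgE !mulgA -(mulgA _ k h) Nx mulgA mulgVK.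
exists (NormalSubgroup NP) => /=; last first.
  by move=> x /(_ 1 1); rewrite !mul1g !mulg1 => /iffRL/(_ U1)/UA.
apply: (subgroup_open NP.1).
have cTT : compact [set: T * T] by rewrite -setXTT; exact: compact_setX.
have /compact_near_coveringP/(_ T (nbhs 1)
  (fun x gh => U (gh.1 * x * gh.2) <-> U (gh.1 * gh.2)) _) cov := cTT.
have {}cov : (forall gh : T * T, \forall gh' \near gh & x \near nbhs (1 : T),
    U (gh'.1 * x * gh'.2) <-> U (gh'.1 * gh'.2)) -> nbhs 1 N.
  move=> loc; have := cov (fun gh _ => loc gh).
  by apply: filterS => x Nx g h; exact: (Nx (g, h)).
apply: cov => -[g h].
pose phi (w : T * T * T) := w.1.1 * w.2 * w.1.2.
pose psi (w : T * T * T) := w.1.1 * w.1.2.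
have mulc (X : topologicalType) (u v : X -> T) (x : X) :
    {for x, continuous u} -> {for x, continuous v} ->
    {for x, continuous (fun y => u y * v y)}.
  move=> cu cv.
  apply: (@cvg_comp _ _ _ (fun z => (u z, v z)) (fun xy => xy.1 * xy.2));
    last exact: (mulg_continuous (u x, v x)).
  by apply: cvg_pair.
pose w0 : T * T * T := (g, h, 1).
have c11 : {for w0, continuous (fun w : T * T * T => w.1.1)}.
  by apply: (@cvg_comp _ _ _ fst fst); [exact: cvg_fst|exact: cvg_fst].
have c12 : {for w0, continuous (fun w : T * T * T => w.1.2)}.
  by apply: (@cvg_comp _ _ _ fst snd); [exact: cvg_fst|exact: cvg_snd].
have c2 : {for w0, continuous (fun w : T * T * T => w.2)} by exact: cvg_snd.
have cphi : {for w0, continuous phi} by exact: mulc (mulc _ _ _ _ c11 c2) c12.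
have cpsi : {for w0, continuous psi} by exact: mulc c11 c12.
suff : nbhs w0 [set w | U (phi w) <-> U (psi w)] by [].
have near_both (V : set T) : nbhs (g * h) V ->
    nbhs w0 [set w | V (phi w) /\ V (psi w)].
  move=> nV; apply: (@filterI _ (nbhs w0) _ (phi @^-1` V) (psi @^-1` V)).
    by apply: cphi; rewrite /phi /= mulg1.
  exact: cpsi.
have [Ugh|nUgh] := pselect (U (g * h)).
- have nU : nbhs (g * h) U by exact: open_nbhs_nbhs.
  by apply: filterS (near_both U nU) => w [].
- have nU : nbhs (g * h) (~` U).
    by apply: open_nbhs_nbhs; split=> //; exact: closed_openC.
  by apply: filterS (near_both _ nU) => w [].
Qed.

End TopGroup.

(** * The topology of the completion *)

Lemma pNormal_inhabited p (G : groupType) : inhabited (pNormal p G).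
Proof.
have TP : is_normal [set: G] by [].
suff pT : p_index p (NormalSubgroup TP) by exists; exact: PNormal pT.
have oneM : {morph (fun _ : G => 1 : {perm void}) : x y / x * y}.
  by move=> x y; rewrite mulg1.
apply: (@p_index_kernel _ _ _ (morph_hom oneM)) => //.
rewrite /pgroup (_ : #|_| = 1)%N //; apply/eqP/cards1P; exists 1.
by apply/finset.setP => s; rewrite !inE; apply/esym/eqP/perm.permP; case.
Qed.

Section CompletionTopology.
Variables (p : nat) (G : groupType).
Local Notation hatG := (completion p G).

(** Two subgroups of p-power index contain a third one, so the sets of elements
    with a prescribed single component form a base and not only a subbase. *)
Lemma nbhs_completionP (a : hatG) (A : set hatG) :
  nbhs a A <-> exists N, [set b : hatG | b N = a N] `<=` A.
Proof.
split=> [aA|[N NA]]; last exact: filterS (nbhs_component a N).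
pose F := filter_from [set: pNormal p G] (fun N => [set b : hatG | b N = a N]).
have FF : Filter F.
  apply: filter_fromT_filter.
    by have [N] := pNormal_inhabited p G; exists N.
  move=> N M; have [L LN LM] := p_index_inter (pnormalP N) (pnormalP M).
  exists L => b /= ab; have [x ax] := quot_proj_surj (a L).
  rewrite (componentP LN ax) (componentP LM ax).
  by split; [apply: (componentP LN)|apply: (componentP LM)]; rewrite ab.
have Fa : F --> a.
  by apply: cvg_completion => N; exists N.
by have [N _ NA] := Fa A aA; exists N.
Qed.

Lemma component_clopen (N : pNormal p G) (S : set (quot N)) :
  clopen [set b : hatG | S (b N)].
Proof.
have opS (R : set (quot N)) : open [set b : hatG | R (b N)].
  rewrite openE => a Ra; apply/nbhs_completionP.
  by exists N => b /= ->.
split; first exact: opS.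
rewrite -[X in closed X]setCK; apply: open_closedC; exact: (opS (~` S)).
Qed.

Lemma completion_dense (a : hatG) N : exists x, to_completion p x N = a N.
Proof. by have [x ->] := quot_proj_surj (a N); exists x. Qed.

(** An ultrafilter F on the completion selects one class z_N in each finite
    quotient G / N; the classes z_N are compatible and F converges to them. *)
Lemma completion_compact : compact [set: hatG].
Proof.
rewrite compact_ultra => F FU _.
have FF : ProperFilter F by exact: ultra_proper.
have ex (N : pNormal p G) : exists z : quot N, F [set b : hatG | b N = z].
  apply: contrapT => noz.
  have [P [phi [_ _ phi_surj]]] := pnormalP N.
  have : \forall b \near F, forall w : P, (b : hatG) N <> phi w.
    apply: filter_forall => w.
    have [Fw|//] := in_ultra_setVsetC [set b : hatG | b N = phi w] FU.
    by case: noz; exists (phi w).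
  move=> /filter_ex[b nb]; have : [set: quot N] (b N) by [].
  by rewrite -phi_surj => -[w _ /esym/nb].
pose z N := projT1 (cid (ex N)).
have Fz N : F [set b : hatG | b N = z N] := projT2 (cid (ex N)).
have zP (N M : pNormal p G) : normal_set N `<=` normal_set M ->
    forall x, z N = quot_proj N x -> z M = quot_proj M x.
  move=> NM x zx; have [b [bN <-]] := filter_ex (filterI (Fz N) (Fz M)).
  by apply: (componentP NM); rewrite bN.
by exists (Completion zP); split=> //; exact: cvg_completion.
Qed.

Lemma completion_hausdorff : hausdorff_space hatG.
Proof.
move=> a b ab; apply: completionP => N.
by have [c [/= <- <-]] := ab _ _ (nbhs_component a N) (nbhs_component b N).
Qed.

Lemma completion_totally_disconnected : totally_disconnected [set: hatG].
Proof.
apply: zero_dimension_totally_disconnected => a b /eqP ab.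
have [N nN] : exists N, a N <> b N.
  apply: contrapT => /forallNP ne; apply/ab/completionP => N.
  exact: contrapT.
exists [set c : hatG | c N = a N]; split=> //=; last exact: nesym.
exact: (@component_clopen N [set z | z = a N]).
Qed.

(** An open normal subgroup M contains the kernel of the projection to some
    G / N, so the quotient by M is a quotient of the p-group G / N. *)
Lemma completion_pro_p : is_pro_p p hatG.
Proof.
split; [exact: completion_compact | exact: completion_hausdorff |
  exact: completion_totally_disconnected |].
move=> M Mop.
have [N NM] : exists N, [set b : hatG | b N = (1 : hatG) N] `<=` normal_set M.
  apply/nbhs_completionP/open_nbhs_nbhs; split=> //.
  exact: (normal_setP M).1.1.
have [W [f [pW fN _]]] := p_index_hom (pnormalP N).
pose F (a : hatG) := f (repr (a N)).
have FE (a : hatG) x : a N = quot_proj N x -> F a = f x.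
  move=> ax; apply: (mulgI (F a)^-1); rewrite mulVg -multiplicativeV -gmulfM.
  apply/esym/fN; apply/quot_projP.
  by rewrite -ax /quot_proj reprK.
have FM : {morph F : a b / a * b}.
  move=> a b; have [x ax] := quot_proj_surj (a N).
  have [y bY] := quot_proj_surj (b N).
  rewrite (FE _ _ ax) (FE _ _ bY) -gmulfM; apply: FE.
  by rewrite -[LHS]/(a N * b N) ax bY -gmulfM.
apply: (@p_index_kernel _ _ _ (morph_hom FM)) => // a /fN Na; apply: NM => /=.
rewrite -[a N]reprK; apply/esym/quot_projP.
by rewrite invg1 mul1g.
Qed.

Lemma completion_eq_dense (T : topGroupType) (u v : hatG -> T) :
  hausdorff_space T -> continuous u -> continuous v ->
  (forall x, u (to_completion p x) = v (to_completion p x)) -> u =1 v.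
Proof.
move=> hT cu cv uv a; apply: hT => A B uA vB.
have nA : nbhs a (u @^-1` A) by exact: cu.
have nB : nbhs a (v @^-1` B) by exact: cv.
have [N NAB] := (nbhs_completionP _ _).1 (filterI nA nB).
have [x /NAB[Ax Bx]] := completion_dense a N.
by exists (u (to_completion p x)); split=> //; rewrite uv.
Qed.

Section Extension.
Variables (T : topGroupType) (T_pro_p : is_pro_p p T).
Variable g : {multiplicative G -> T}.

(** The relation between a and the limit t of g(x) as x in G tends to a,
    expressed with the open normal subgroups M only. *)
Let limit_at (a : hatG) (t : T) := forall M : pNormal p T,
  open (normal_set M) -> forall x, a (preimage_pnormal g M) = quot_proj _ x ->
  normal_set M (t^-1 * g x).

Let base (A : set T) : nbhs 1 A ->
  exists2 M : pNormal p T, open (normal_set M) & normal_set M `<=` A.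
Proof.
case: T_pro_p => cT hT tdT pT A1.
have [M Mop MA] := open_normal_subgroup_in cT hT tdT A1.
by exists (PNormal (pT M Mop)).
Qed.

Let limit_ex a : exists t, limit_at a t.
Proof.
case: T_pro_p => cT _ _ _.
pose F := filter_from [set: pNormal p G]
  (fun N => g @` [set x | a N = quot_proj N x]).
have FF : ProperFilter F.
  apply: filter_from_proper; last first.
    by move=> N _; have [x ax] := quot_proj_surj (a N); exists (g x), x.
  apply: filter_fromT_filter.
    by have [N] := pNormal_inhabited p G; exists N.
  move=> N M; have [L LN LM] := p_index_inter (pnormalP N) (pnormalP M).
  exists L => _ [x ax <-].
  by split; exists x => //; [apply: (componentP LN)|apply: (componentP LM)].
have [|t [_ tF]] := cT F FF.
  by have [N] := pNormal_inhabited p G; exists N.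
exists t => M Mop x ax.
have M1 : nbhs 1 (normal_set M).
  by apply: open_nbhs_nbhs; split=> //; exact: (normal_setP M).1.1.
have FM : F (g @` [set y | a (preimage_pnormal g M) = quot_proj _ y]).
  by exists (preimage_pnormal g M).
have [_ [[y ay <-] My]] := tF _ _ FM (translate_nbhs t M1).
have /quot_projP/(is_subgroupM (normal_setP M).1 My) :
  quot_proj (preimage_pnormal g M) y = quot_proj (preimage_pnormal g M) x.
  by rewrite -ay -ax.
by rewrite gmulfM multiplicativeV -!mulgA mulKVg.
Qed.

Let limit_uniq a t s : limit_at a t -> limit_at a s -> t = s.
Proof.
case: T_pro_p => _ hT _ _ ta sa; apply: hT => A B tA sB.
have tAs : nbhs 1 (fun x => A (t * x)).
  by have := @mulg_left_continuous T t 1 A; rewrite mulg1; apply.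
have sBs : nbhs 1 (fun x => B (s * x)).
  by have := @mulg_left_continuous T s 1 B; rewrite mulg1; apply.
have [M Mop MAB] := base (filterI tAs sBs).
have [x ax] := quot_proj_surj (a (preimage_pnormal g M)).
have [+ _] := MAB _ (ta M Mop x ax); rewrite mulVKg => Ax.
have [_ +] := MAB _ (sa M Mop x ax); rewrite mulVKg => Bx.
by exists (g x).
Qed.

(** The image of a is the limit of g(x) as x tends to a. It exists because T is
    compact and g(x) eventually stays in one coset of each open normal subgroup
    M, the quotient T / M being a finite p-group; it is unique because these
    subgroups form a base at 1 and T is Hausdorff. *)
Lemma completion_extension : exists u : {multiplicative hatG -> T},
  continuous u /\ u \o @to_completion p G =1 g.
Proof.
pose u a := projT1 (cid (limit_ex a)).
have uP a : limit_at a (u a) := projT2 (cid (limit_ex a)).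
have uM : {morph u : a b / a * b}.
  move=> a b; apply: limit_uniq (uP _) _ => M Mop z abz.
  have [x ax] := quot_proj_surj (a (preimage_pnormal g M)).
  have [y bY] := quot_proj_surj (b (preimage_pnormal g M)).
  have Ms := (normal_setP M).1.
  have : quot_proj (preimage_pnormal g M) (x * y) =
      quot_proj (preimage_pnormal g M) z.
    by rewrite -abz -[RHS]/(a _ * b _) ax bY -gmulfM.
  move=> /quot_projP; rewrite /= gmulfM multiplicativeV => Mz.
  have Mxy : normal_set M ((u a * u b)^-1 * g (x * y)).
    have Mx := (normal_setP M).2 _ (u b) (uP a M Mop x ax).
    have := is_subgroupM Ms Mx (uP b M Mop y bY).
    by rewrite conjgE invMg gmulfM !mulgA mulgK.
  by have := is_subgroupM Ms Mxy Mz; rewrite -!mulgA mulVKg.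
exists (morph_hom uM); split=> [a A uA|x] /=.
  have : nbhs 1 (fun x => A (u a * x)).
    by have := @mulg_left_continuous T (u a) 1 A; rewrite mulg1; apply.
  move=> /base[M Mop MA]; apply/nbhs_completionP; exists (preimage_pnormal g M).
  move=> b /= ab; have [x ax] := quot_proj_surj (a (preimage_pnormal g M)).
  have Ms := (normal_setP M).1.
  have bx := uP b M Mop x (etrans ab ax).
  have := MA _ (is_subgroupM Ms (uP a M Mop x ax) (is_subgroupV Ms bx)).
  by rewrite invMg invgK !mulgA mulgK mulgV mul1g.
apply: limit_uniq (uP _) _ => M Mop y /quot_projP /=.
by rewrite gmulfM multiplicativeV.
Qed.

End Extension.
End CompletionTopology.

(** * Pro-p pushouts and the completed amalgam *)

Lemma completion_map_inj p (G H : groupType) (f : {multiplicative G -> H}) :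
  (forall U : pNormal p G, exists N : pNormal p H,
    f @^-1` normal_set N `<=` normal_set U) ->
  injective (completion_map p f).
Proof.
move=> cof a b ab; apply: completionP => U; have [N NU] := cof U.
have [x ax] := quot_proj_surj (a (preimage_pnormal f N)).
have [y bY] := quot_proj_surj (b (preimage_pnormal f N)).
have /= : completion_map p f a N = completion_map p f b N by rewrite ab.
rewrite (completion_map_componentE ax) (completion_map_componentE bY).
move=> /quot_projP; rewrite -multiplicativeV -gmulfM => Nxy.
have {}NU : normal_set (preimage_pnormal f N) `<=` normal_set U := NU.
by rewrite (componentP NU ax) (componentP NU bY); apply/quot_projP/NU.
Qed.

Section Pushout.
Variables (p : nat) (K H1 H2 Gamma : groupType)
  (k1 : {multiplicative K -> H1}) (k2 : {multiplicative K -> H2})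
  (i1 : {multiplicative H1 -> Gamma}) (i2 : {multiplicative H2 -> Gamma}).
Hypothesis Gamma_amalgam : is_group_pushout k1 k2 i1 i2.

Lemma completion_pushout :
  is_pro_p_pushout p (completion_map p k1) (completion_map p k2)
    (completion_map p i1 : {multiplicative _ -> completion p Gamma})
    (completion_map p i2).
Proof.
have cont := completion_map_continuous.
have cont_comp (X Y Z : topologicalType) (u : X -> Y) (v : Y -> Z) :
  continuous u -> continuous v -> continuous (v \o u).
  by move=> cu cv x; apply: continuous_comp; [exact: cu|exact: cv].
split; [exact: completion_pro_p | exact: cont | exact: cont | |].
  apply: completion_eq_dense (@completion_hausdorff p Gamma) _ _ _ => [||x].
  - exact: cont_comp (cont _ _ _ k1) (cont _ _ _ i1).
  - exact: cont_comp (cont _ _ _ k2) (cont _ _ _ i2).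
  - rewrite /= !completion_map_natural; congr to_completion.
    exact: Gamma_amalgam.1.
move=> T g1 g2 pT cg1 cg2 g12; have hT : hausdorff_space T by case: pT.
split.
  have [|[g [g1E g2E]] _] := Gamma_amalgam.2 T (g1 \o @to_completion p H1)
    (g2 \o @to_completion p H2).
    by move=> x /=; rewrite -!completion_map_natural; exact: g12.
  have [u [cu uE]] := completion_extension pT g.
  exists u; split=> //.
    apply: completion_eq_dense hT _ cg1 _ => [|x].
      exact: cont_comp (cont _ _ _ i1) cu.
    by rewrite /= completion_map_natural -[RHS]g1E; exact: uE.
  apply: completion_eq_dense hT _ cg2 _ => [|x].
    exact: cont_comp (cont _ _ _ i2) cu.
  by rewrite /= completion_map_natural -[RHS]g2E; exact: uE.
move=> u v cu cv uv1 uv2; apply: completion_eq_dense hT cu cv _.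
have [|_ uniq] := Gamma_amalgam.2 T (u \o @to_completion p Gamma \o i1)
    (u \o @to_completion p Gamma \o i2).
  by move=> x /=; congr (u (to_completion p _)); exact: Gamma_amalgam.1.
apply: (uniq (u \o @to_completion p Gamma)
  (v \o @to_completion p Gamma)) => h /=.
  by rewrite -!completion_map_natural; exact: uv1.
by rewrite -!completion_map_natural; exact: uv2.
Qed.

End Pushout.

Lemma pro_p_pushout_unique p (A G1 G2 P P' : topGroupType)
    (f1 : {multiplicative A -> G1}) (f2 : {multiplicative A -> G2})
    (j1 : {multiplicative G1 -> P}) (j2 : {multiplicative G2 -> P})
    (l1 : {multiplicative G1 -> P'}) (l2 : {multiplicative G2 -> P'}) :
  is_pro_p_pushout p f1 f2 j1 j2 -> is_pro_p_pushout p f1 f2 l1 l2 ->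
  exists u : {multiplicative P -> P'},
    [/\ is_top_iso u, u \o j1 =1 l1 & u \o j2 =1 l2].
Proof.
move=> [pP cj1 cj2 j12 univ] [pP' cl1 cl2 l12 univ'].
have [[u [cu u1 u2]] _] := univ P' l1 l2 pP' cl1 cl2 l12.
have [[v [cv v1 v2]] _] := univ' P j1 j2 pP cj1 cj2 j12.
have [_ uniq] := univ P j1 j2 pP cj1 cj2 j12.
have [_ uniq'] := univ' P' l1 l2 pP' cl1 cl2 l12.
exists u; split=> //; split=> //; exists v => //; split.
- apply: (uniq (v \o u) idfun) => [x|x|x|x] /=.
  + by apply: continuous_comp; [exact: cu|exact: cv].
  + exact: cvg_id.
  + by rewrite [u _]u1; exact: v1.
  + by rewrite [u _]u2; exact: v2.
- apply: (uniq' (u \o v) idfun) => [x|x|x|x] /=.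
  + by apply: continuous_comp; [exact: cv|exact: cu].
  + exact: cvg_id.
  + by rewrite [v _]v1; exact: u1.
  + by rewrite [v _]v2; exact: u2.
Qed.
Theorem theorem6p6 (p : nat) (p_prime : prime p) (K H1 H2 Gamma : groupType)
    (k1 : {multiplicative K -> H1}) (k2 : {multiplicative K -> H2})
    (i1 : {multiplicative H1 -> Gamma}) (i2 : {multiplicative H2 -> Gamma})
    (k1_inj : injective k1) (k2_inj : injective k2)
    (Gamma_amalgam : is_group_pushout k1 k2 i1 i2)
    (K_normal1 : is_normal (range k1)) (K_normal2 : is_normal (range k2))
    (K_index1 : p_index p (NormalSubgroup K_normal1))
    (K_index2 : p_index p (NormalSubgroup K_normal2))
    (LL : set (normalSubgroup K))
    (LL_char : forall L, LL L -> is_characteristic (normal_set L))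
    (LL_index : forall L, LL L -> p_index p L)
    (LL_cofinal : forall U : normalSubgroup K, p_index p U ->
      exists2 L, LL L & normal_set L `<=` normal_set U)
    (LL_action : forall L, LL L ->
      is_finite_pgroup p
        (generated_subgroup (conj_action k1 L `|` conj_action k2 L))) :
  [/\ injective (completion_map p k1), injective (completion_map p k2),
    (exists (P : topGroupType)
        (j1 : {multiplicative completion p H1 -> P})
        (j2 : {multiplicative completion p H2 -> P}),
      is_pro_p_pushout p (completion_map p k1) (completion_map p k2) j1 j2) &
    forall (P : topGroupType)
        (j1 : {multiplicative completion p H1 -> P})
        (j2 : {multiplicative completion p H2 -> P}),
      is_pro_p_pushout p (completion_map p k1) (completion_map p k2) j1 j2 ->
      [/\ injective j1, injective j2 &
        exists u : {multiplicative P -> completion p Gamma},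
          [/\ is_top_iso u, u \o j1 =1 completion_map p i1 &
            u \o j2 =1 completion_map p i2]]].
Proof.
(* L is in the given family, and N meets each H_i within L. *)
have quo (U : pNormal p K) : exists L : normalSubgroup K,
    normal_set L `<=` normal_set U /\ exists N : pNormal p Gamma,
    (forall h, normal_set N (i1 h) -> exists2 x, h = k1 x & normal_set L x) /\
    (forall h, normal_set N (i2 h) -> exists2 x, h = k2 x & normal_set L x).
  have [L LLL LU] := LL_cofinal _ (pnormalP U); exists L; split=> //.
  exact: (amalgam_to_pgroup k1_inj k2_inj Gamma_amalgam K_index1 K_index2
    (LL_char _ LLL) (LL_index _ LLL) (LL_action _ LLL)).
have i1_inj : injective (completion_map p i1).
  apply: completion_map_inj => V.
  have [L [LV [N [N1 _]]]] := quo (preimage_pnormal k1 V).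
  by exists N => h /N1[x -> /LV].
have i2_inj : injective (completion_map p i2).
  apply: completion_map_inj => V.
  have [L [LV [N [_ N2]]]] := quo (preimage_pnormal k2 V).
  by exists N => h /N2[x -> /LV].
have push := completion_pushout p Gamma_amalgam.
split.
- apply: completion_map_inj => U; have [L [LU [N [N1 _]]]] := quo U.
  by exists (preimage_pnormal i1 N) => x /N1[y /k1_inj -> /LU].
- apply: completion_map_inj => U; have [L [LU [N [_ N2]]]] := quo U.
  by exists (preimage_pnormal i2 N) => x /N2[y /k2_inj -> /LU].
- by exists (completion p Gamma), (completion_map p i1), (completion_map p i2).
move=> P j1 j2 pushP.
have [u [u_iso u1 u2]] := pro_p_pushout_unique pushP push.
split; last by exists u.
- by move=> x y xy; apply: i1_inj; rewrite -u1 -u1 /= xy.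
- by move=> x y xy; apply: i2_inj; rewrite -u2 -u2 /= xy.
Qed.
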